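(* Let $M$ be an oriented matroid of rank $r$ on a finite set $E$, and let $\overline{M}$ be a generic extension-lifting of $M$ with respect to $(f,g)$. (i) In an arrangement of $\overline{M}$, every vertex not in $g$ and not in $f$ is the intersection of exactly $r$ elements, forming a basis of $M$. (Equivalently: for every cocircuit of $\overline{M}$ whose support contains both $f$ and $g$, there are exactly $r$ elements of $E\cup\{f,g\}$ outside this support, and they form a basis of $M$.) (ii) The mapping $B\mapsto (E\setminus B)\cup\{f,g\}$ is a bijection between bases of $M$ and (supports of) cocircuits of $\overline{M}$ containing $f$ and $g$ (these are the cocircuits corresponding to the vertices addressed in item (i)). (iii) The mapping $B\mapsto B\cup\{g\}$ is a bijection between bases of $M$ and bases of $\overline{M}$ containing $g$ and not containing $f$ (the fundamental cocircuits of these bases of $\overline{M}$ with respect to $g$ are the cocircuits addressed in item (ii)). (iv) For every basis $B\cup\{g\}$ of $\overline{M}$ containing $g$ and not $f$ (with $g\notin B$), one has, in $\overline{M}$, $f\in C^*(B\cup\{g\};b)$ for every $b\in B$, and $g\in C(B\cup\{g\};e)$ for every $e\in E\setminus B$. In particular, $C(B\cup\{g\};f)$ has $B\cup\{f,g\}$ as support.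
   Context: All oriented matroids are on finite ground sets. An extension of an oriented matroid $N$ on $S$ with respect to $f\notin S$ is an oriented matroid $\overline{N}$ on $S\cup\{f\}$ with $\overline{N}\setminus f=N$ (deletion); it is generic if every circuit of $\overline{N}$ containing $f$ is spanning, that is, the supports of circuits of $\overline{N}$ containing $f$ are exactly the sets $B\cup\{f\}$ with $B$ a basis of $N$. A lifting of $N$ with respect to $g\notin S$ is an oriented matroid $\overline{N}$ on $S\cup\{g\}$ with $\overline{N}/g=N$ (contraction); it is generic if the supports of cocircuits of $\overline{N}$ containing $g$ are exactly the sets $(S\setminus B)\cup\{g\}$ with $B$ a basis of $N$. Let $M$ be an oriented matroid on $E$ and $f\neq g$ elements not in $E$. A generic extension-lifting of $M$ with respect to $(f,g)$ is an oriented matroid $\overline{M}$ on $E\cup\{f,g\}$ such that $(\overline{M}/g)\setminus f=M$, $\overline{M}$ is a generic extension of $\overline{M}\setminus f$ with respect to $f$, and $\overline{M}$ is a generic lifting of $\overline{M}/g$ with respect to $g$ ($f$ and $g$ are not loops nor coloops of $\overline{M}$). An arrangement of an oriented matroid is a signed pseudosphere arrangement representing it; cocircuits correspond to its vertices, and a vertex lies in (the pseudosphere of) an element $e$ if and only if $e$ is not in the support of the corresponding cocircuit. For a basis $B$ of an oriented matroid: for $b\in B$, $C^*(B;b)$ is the fundamental cocircuit, i.e. the signed cocircuit whose support is the complement of the closure of $B\setminus\{b\}$, with positive sign on $b$; for $e\notin B$, $C(B;e)$ is the fundamental circuit, i.e. the signed circuit with support contained in $B\cup\{e\}$, with positive sign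 on $e$. Membership of an element in a signed set means membership in its support. *)

(* Defs.v *)
From mathcomp Require Import all_boot.

Set Implicit Arguments.
Unset Strict Implicit.
Unset Printing Implicit Defensive.

(* A signed subset of T, as a sign vector: Some true is +, Some false is -,
   and None is 0 (not in the support). *)
Notation signed_set T := {ffun T -> option bool}.

Section SignedSets.
Variable T : finType.
Implicit Types (X Y : signed_set T) (A : {set T}) (S : {set signed_set T}).

Definition supp X : {set T} := [set x | X x != None].
Definition pos X : {set T} := [set x | X x == Some true].
Definition neg X : {set T} := [set x | X x == Some false].
Definition opp X : signed_set T := [ffun x => omap negb (X x)].
Definition remove A X : signed_set T :=
  [ffun x => if x \in A then None else X x].

(* Either the supports are disjoint, or the signs agree somewhere and disagree
   somewhere on the intersection of the supports. *)
Definition orthogonal X Y : bool :=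
  [|| supp X :&: supp Y == set0
    | [exists x in supp X :&: supp Y, X x == Y x] &&
      [exists x in supp X :&: supp Y, X x != Y x]].

Definition min_supp S : {set signed_set T} :=
  [set X in S | (supp X != set0) &&
     [forall Y in S, (supp Y != set0) ==> ~~ (supp Y \proper supp X)]].

End SignedSets.

(* Ground set and signed circuits are kept separate from the circuit axioms
   (predicate oriented_matroid below), so that minors are plain operations and
   equality of oriented matroids is equality of ground sets and circuits. *)
Record signed_system (T : finType) := SignedSystem {
  ground : {set T};
  circuits : {set signed_set T}
}.

Section OrientedMatroids.
Variable T : finType.
Implicit Types (N : signed_system T) (X Y Z : signed_set T) (A B : {set T})
  (e b f g : T).

Record oriented_matroid N : Prop := OrientedMatroid {
  circuit_ground : forall X, X \in circuits N -> supp X \subset ground N;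
  circuit_nonempty : forall X, X \in circuits N -> supp X != set0;
  circuit_opp : forall X, X \in circuits N -> opp X \in circuits N;
  circuit_incomparable : forall X Y, X \in circuits N -> Y \in circuits N ->
    supp X \subset supp Y -> X = Y \/ X = opp Y;
  circuit_elimination : forall X Y e, X \in circuits N -> Y \in circuits N ->
    X != opp Y -> e \in pos X :&: neg Y ->
    exists Z, [/\ Z \in circuits N,
                  pos Z \subset (pos X :|: pos Y) :\ e &
                  neg Z \subset (neg X :|: neg Y) :\ e]
}.

Definition independent N A : bool :=
  (A \subset ground N) && [forall X in circuits N, ~~ (supp X \subset A)].

Definition bases N : {set {set T}} := [set B | maxset (independent N) B].

Definition rank_of N A : nat :=
  \max_(I : {set T} | independent N I && (I \subset A)) #|I|.

Definition rank N : nat := rank_of N (ground N).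

Definition closure N A : {set T} :=
  [set e in ground N | rank_of N (e |: A) == rank_of N A].

(* The signed circuits of the dual: the signed subsets of the ground set that
   are orthogonal to all circuits, nonempty, and of minimal support. *)
Definition cocircuits N : {set signed_set T} :=
  min_supp [set Y : signed_set T | (supp Y \subset ground N) &&
                                   [forall X in circuits N, orthogonal X Y]].

Definition deletion N e : signed_system T :=
  SignedSystem (ground N :\ e) [set X in circuits N | e \notin supp X].

Definition contraction N e : signed_system T :=
  SignedSystem (ground N :\ e)
               (min_supp [set remove [set e] X | X in circuits N]).

(* In an oriented matroid, when B is a basis, there is exactly one candidate
   in each of the two picks below; the empty signed set is a junk value. *)
Definition fund_circuit N B e : signed_set T :=
  odflt [ffun=> None]
    [pick X in circuits N | (supp X \subset e |: B) && (X e == Some true)].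

Definition fund_cocircuit N B b : signed_set T :=
  odflt [ffun=> None]
    [pick Y in cocircuits N |
       (supp Y == ground N :\: closure N (B :\ b)) && (Y b == Some true)].

Definition extension N f Nbar : Prop :=
  [/\ f \notin ground N, oriented_matroid Nbar,
      ground Nbar = f |: ground N & deletion Nbar f = N].

Definition generic_extension N f Nbar : Prop :=
  extension N f Nbar /\
  [set supp X | X in circuits Nbar & f \in supp X] =
  [set f |: B | B in bases N].

Definition lifting N g Nbar : Prop :=
  [/\ g \notin ground N, oriented_matroid Nbar,
      ground Nbar = g |: ground N & contraction Nbar g = N].

Definition generic_lifting N g Nbar : Prop :=
  lifting N g Nbar /\
  [set supp Y | Y in cocircuits Nbar & g \in supp Y] =
  [set g |: (ground N :\: B) | B in bases N].

(* It follows that f and g are neither loops nor coloops of Mbar: f lies in a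
   circuit and g in a cocircuit; if f were a loop then so would be g, and if g
   were a coloop it would lie in every circuit containing f. *)
Definition generic_extension_lifting (M : signed_system T) f g Mbar : Prop :=
  [/\ oriented_matroid Mbar,
      ground Mbar = ground M :|: [set f; g],
      deletion (contraction Mbar g) f = M,
      generic_extension (deletion Mbar f) f Mbar &
      generic_lifting (contraction Mbar g) g Mbar].

End OrientedMatroids.

Definition bijection_between (I J : finType) (phi : I -> J)
    (P : {set I}) (Q : {set J}) : Prop :=
  {in P &, injective phi} /\ phi @: P = Q.

(* Main.v *)
Require Import Defs.
From mathcomp Require Import all_boot.

(** Write N for Mbar, E for the ground set of M, and B for a subset of E.

    The hypotheses turn into one dictionary: B is a basis of M if and only if
    g |: B is a basis of N ([basis_base_matroid]).  For the contraction by g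
    this is matroid theory, g being no loop because it lies in a cocircuit.
    For the deletion of f, genericity of the extension says that adding f to a
    basis of N \ f produces the support of a circuit, so that the bases of
    N \ f are bases of N and nothing is lost by avoiding f.  With the
    dictionary, genericity of the lifting describes the cocircuits through f
    and g as the complements of the bases of M; conversely each basis B of M,
    being the complement of a cocircuit, is closed in N
    ([closure_base_basis]).  Hence the fundamental cocircuit of g |: B with
    respect to g avoids B alone.  A circuit in e |: B with e in E \ B would put
    e in the closure of B, so the fundamental circuit of e with respect to
    g |: B contains g.  And a circuit through f is spanning
    ([extension_circuit_spanning]), so that none lies in f |: A for a proper
    subset A of the basis g |: B: thus f is outside the closure of
    (g |: B) \ b for every b in B.

    The remaining point is that fundamental cocircuits exist as signed sets.
    Cocircuits are defined here by orthogonality to all circuits, so this is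
    the existence half of oriented matroid duality
    ([cocircuit_closure_exists]).  For a basis b |: I of N, with b not in I, let H be
    the hyperplane spanned by I.
    For a basis J of H and two elements e, h outside H there is, up to sign, one
    circuit D in J + e + h.  Whether D has equal signs at e and h does not
    depend on J: this is checked for an exchange of one element of J
    ([sign_exchange]) and extended along a chain of exchanges
    ([sign_consistent]).  Comparing every e with b thus defines the signs of a
    vector Y on the complement of H.  If some circuit X agreed with Y on their
    nonempty common support, eliminating an element e other than b between X
    and the circuit in J + b + e, where J contains the independent part of X in H,
    would give a circuit agreeing with Y as well and with fewer elements outside
    H + b ([coc_not_agree]).  The choice of J makes weak elimination
    sufficient: the new circuit cannot vanish outside H, since its part in H is
    contained in J. *)

Set Implicit Arguments.
Unset Strict Implicit.
Unset Printing Implicit Defensive.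

(** * Sign vectors *)

Section SignVectors.
Variable T : finType.
Implicit Types (X Y : signed_set T) (S : {set signed_set T}).

Lemma in_supp X x : (x \in supp X) = (X x != None).
Proof. by rewrite inE. Qed.

Lemma oppK : involutive (@opp T).
Proof. by move=> X; apply/ffunP => x; rewrite !ffunE; case: (X x) => [[]|]. Qed.

Lemma supp_opp X : supp (opp X) = supp X.
Proof. by apply/setP => x; rewrite !in_supp ffunE; case: (X x). Qed.

Lemma supp_remove1 X e : supp (remove [set e] X) = supp X :\ e.
Proof.
by apply/setP => x; rewrite in_setD1 !in_supp ffunE in_set1; case: (x == e).
Qed.

Lemma orthogonal_supp_neq1 X Y x :
  orthogonal X Y -> supp X :&: supp Y != [set x].
Proof.
rewrite /orthogonal => /orP[/eqP->|/andP[/existsP[y /andP[yI /eqP yE]]]].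
  by apply/eqP => /setP/(_ x); rewrite !inE eqxx.
case/existsP => z /andP[zI zN]; apply: contraNneq zN => XYx.
by move: yI zI yE; rewrite XYx !inE => /eqP-> /eqP-> ->.
Qed.

Lemma not_orthogonal_agree X Y :
  (exists x, (x \in supp X) && (x \in supp Y)) -> ~~ orthogonal X Y ->
  (forall x, x \in supp X -> x \in supp Y -> X x = Y x) \/
  (forall x, x \in supp X -> x \in supp Y -> opp X x = Y x).
Proof.
case=> x xXY; rewrite negb_or negb_and => /andP[_] /orP[] /existsPn h.
  right=> y yX yY; move: (h y); rewrite inE yX yY ffunE.
  by move: yX yY; rewrite !in_supp; case: (X y) => [[]|]; case: (Y y) => [[]|].
left=> y yX yY; move: (h y); rewrite inE yX yY.
by move=> /negPn/eqP.
Qed.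

Lemma min_supp_exists S X : X \in S -> supp X != set0 ->
  exists2 Z, Z \in min_supp S & supp Z \subset supp X.
Proof.
move=> XS X0.
pose P Z := [&& Z \in S, supp Z != set0 & supp Z \subset supp X].
have PX : P X by rewrite /P XS X0 /=.
case: (arg_minnP (fun Z => #|supp Z|) PX) => Z /and3P[ZS Z0 ZX] minZ.
exists Z => //; rewrite inE ZS Z0; apply/forall_inP => W WS; apply/implyP => W0.
apply/negP => WZ; move: (proper_card WZ); rewrite ltnNge minZ //.
by rewrite /P WS W0 (subset_trans (proper_sub WZ) ZX).
Qed.

End SignVectors.

(** * Bases, rank and fundamental circuits *)

Section Matroid.
Variables (T : finType) (N : signed_system T).
Implicit Types (X Y Z D : signed_set T) (A B I J K : {set T}) (a b e h x : T).

Lemma independentP A :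
  reflect (A \subset ground N /\
           forall X, X \in circuits N -> ~ supp X \subset A)
          (independent N A).
Proof.
apply: (iffP andP) => -[AE]; first by move/forall_inP => h; split=> // X /h/negP.
by move=> h; split=> //; apply/forall_inP => X /h/negP.
Qed.

Lemma independent_sub I J : independent N J -> I \subset J -> independent N I.
Proof.
case/independentP => JE h IJ; apply/independentP.
by split=> [|X /h nXJ /subset_trans/(_ IJ)//]; apply: subset_trans JE.
Qed.

Lemma independent_ground I : independent N I -> I \subset ground N.
Proof. by case/andP. Qed.

Lemma dependentP A : A \subset ground N -> ~~ independent N A ->
  exists2 X, X \in circuits N & supp X \subset A.
Proof.
by rewrite /independent => -> /forall_inPn[X XN /negPn XA]; exists X.
Qed.

Lemma basisP B :
  reflect (independent N B /\
           forall A, independent N A -> B \subset A -> A = B)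
          (B \in bases N).
Proof. by rewrite inE; apply: (iffP maxsetP). Qed.

Lemma basis_independent B : B \in bases N -> independent N B.
Proof. by case/basisP. Qed.

Lemma rank_of_independent I : independent N I -> rank_of N I = #|I|.
Proof.
move=> indI; apply/eqP; rewrite eqn_leq; apply/andP; split.
  by apply/bigmax_leqP => J /andP[_ /subset_leq_card].
by rewrite /rank_of (bigmax_sup I) // indI /=.
Qed.

Lemma closure_independent I : independent N I ->
  Defs.closure N I =
    [set e in ground N | (e \in I) || ~~ independent N (e |: I)].
Proof.
move=> indI; apply/setP => e; rewrite !inE; case: (e \in ground N) => //=.
rewrite (rank_of_independent indI).
have [eI|eI] /= := boolP (e \in I).
  by rewrite (setUidPr _) ?sub1set // (rank_of_independent indI) eqxx.
have [indeI|depeI] := boolP (independent N (e |: I)) => /=.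
  by rewrite rank_of_independent // cardsU1 eI add1n eqn_leq ltnn.
apply/eqP/anti_leq/andP; split.
  apply/bigmax_leqP => K /andP[indK KI].
  have : K \proper e |: I.
    by rewrite properEneq KI andbT; apply: contraNneq depeI => <-.
  by move/proper_card; rewrite cardsU1 eI.
by rewrite /rank_of (bigmax_sup I) // indI subsetUr.
Qed.

Hypothesis omN : oriented_matroid N.

(** Stating elimination pointwise makes it symmetric under exchanging the two
    signs, and hence usable for an element of either sign in X. *)
Lemma circuit_elim X Y e s : X \in circuits N -> Y \in circuits N ->
    X != opp Y -> X e = Some s -> Y e = Some (~~ s) ->
  exists Z, [/\ Z \in circuits N, Z e = None &
    forall x c, Z x = Some c -> X x = Some c \/ Y x = Some c].
Proof.
wlog: X Y s / s = true => [wlog_s|->] XN YN XY Xe Ye.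
  case: s Xe Ye => Xe Ye; first exact: (wlog_s X Y true).
  have YX : Y != opp X by apply: contraNneq XY => ->; rewrite oppK.
  have [Z [ZN Ze h]] := wlog_s Y X true (erefl _) YN XN YX Ye Xe.
  by exists Z; split=> // x c /h; case; [right|left].
have eXY : e \in pos X :&: neg Y by rewrite !inE Xe Ye eqxx.
have [Z [ZN /subsetP Zp /subsetP Zn]] := circuit_elimination omN XN YN XY eXY.
exists Z; split=> // [|x c Zx].
  case Ze: (Z e) => [[]|] //.
    by have := Zp e; rewrite !inE Ze !eqxx => /(_ isT).
  by have := Zn e; rewrite !inE Ze !eqxx => /(_ isT).
case: c Zx => Zx.
  by have := Zp x; rewrite !inE Zx => /(_ isT)/andP[_ /orP[]/eqP]; auto.
by have := Zn x; rewrite !inE Zx => /(_ isT)/andP[_ /orP[]/eqP]; auto.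
Qed.

Lemma circuit_unique I e X Y : independent N I ->
    X \in circuits N -> Y \in circuits N ->
    supp X \subset e |: I -> supp Y \subset e |: I ->
  X = Y \/ X = opp Y.
Proof.
case/independentP => _ indI.
have e_in Z : Z \in circuits N -> supp Z \subset e |: I -> Z e != None.
  move=> ZN ZI; rewrite -in_supp; apply/negPn/negP => eZ; apply: (indI Z ZN).
  apply/subsetP => x xZ; have := subsetP ZI x xZ; rewrite !inE.
  by case/orP => // /eqP xe; rewrite -xe xZ in eZ.
(* Two such circuits with opposite signs at e are opposite, since otherwise
   eliminating e leaves a circuit inside I. *)
have main s Z W : Z \in circuits N -> W \in circuits N ->
    supp Z \subset e |: I -> supp W \subset e |: I ->
    Z e = Some s -> W e = Some (~~ s) -> Z = opp W.
  move=> ZN WN ZI WI Ze We; apply/eqP/negPn/negP => ZW.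
  have [V [VN Ve VZW]] := circuit_elim ZN WN ZW Ze We.
  apply: (indI V VN); apply/subsetP => x; rewrite in_supp.
  case Vx: (V x) => [c|] // _.
  have : x \in e |: I.
    case: (VZW x c Vx) => xE.
      by apply: (subsetP ZI); rewrite in_supp xE.
    by apply: (subsetP WI); rewrite in_supp xE.
  by rewrite !inE => /orP[/eqP xe|//]; rewrite xe Ve in Vx.
move=> XN YN XI YI; move: (e_in X XN XI) (e_in Y YN YI).
case Xe: (X e) => [s|] // _; case Ye: (Y e) => [t|] // _.
have [st|st] := eqVneq t (~~ s); first by right; apply: (main s); rewrite // -st.
left; rewrite -[Y]oppK; apply: (main s) => //; rewrite ?supp_opp //.
  exact: circuit_opp.
by rewrite ffunE Ye /=; case: s t st {Xe Ye} => [] [].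
Qed.

(** Among the independent sets K in I :|: J larger than I, take one missing as
    few elements of I as possible.  If K missed e in I, then exchanging any
    y in K \ I for e must create a circuit in e + K avoiding y.  By uniqueness
    all these are one circuit, which avoids K \ I and hence lies in I. *)
Lemma augmentation I J : independent N I -> independent N J -> #|I| < #|J| ->
  exists2 x, x \in J :\: I & independent N (x |: I).
Proof.
move=> indI indJ ltIJ.
pose P K := [&& independent N K, K \subset I :|: J & #|I| < #|K|].
have PJ : P J by rewrite /P indJ subsetUr ltIJ.
case: (arg_minnP (fun K => #|I :\: K|) PJ) => K /and3P[indK KIJ ltIK] minK.
have [IK|] := boolP (I \subset K).
  have /properP[_ [x xK xI]] : I \proper K.
    by rewrite properEcard IK.
  exists x; last by apply: independent_sub indK _; rewrite subUset sub1set xK.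
  by have := subsetP KIJ x xK; rewrite !inE (negPf xI).
case/subsetPn => e eI eK; exfalso.
have swap_dep y : y \in K :\: I ->
    exists2 X, X \in circuits N & supp X \subset e |: (K :\ y).
  rewrite inE => /andP[yI yK]; apply: dependentP.
    rewrite subUset sub1set (subsetP (independent_ground indI)) //=.
    exact: subset_trans (subD1set _ _) (independent_ground indK).
  apply/negP => indK'; suff: #|I :\: K| <= #|I :\: (e |: (K :\ y))|.
    apply/negP; rewrite -ltnNge; apply: proper_card; apply/properP; split.
      apply/subsetP => z; rewrite !inE !negb_or !negb_and => /andP[/andP[_ h] zI].
      by rewrite zI andbT; case/orP: h => // /negPn/eqP zy; rewrite -zy zI in yI.
    by exists e; rewrite !inE ?eqxx ?eI ?eK.
  apply: minK; rewrite /P indK' cardsU1 !inE (negPf eK) andbF add1n.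
  move: ltIK; rewrite (cardsD1 y K) yK add1n => ->; rewrite andbT.
  rewrite subUset sub1set inE eI /=.
  exact: subset_trans (subD1set _ _) KIJ.
have /card_gt0P[y0 y0KI] : 0 < #|K :\: I|.
  have := cardsID I K; have : #|K :&: I| <= #|I| by rewrite subset_leq_card ?subsetIr.
  by case: #|K :\: I| => // h; rewrite addn0 => E; move: ltIK; rewrite -E ltnNge h.
have [X XN XK] := swap_dep y0 y0KI.
have sub y : e |: (K :\ y) \subset e |: K by rewrite setUS ?subD1set.
case/independentP: indI => _ /(_ X XN); apply; apply/subsetP => z zX.
have := subsetP (subset_trans XK (sub _)) z zX.
rewrite !inE => /orP[/eqP->//|zK]; apply/negPn/negP => zI.
have zKI : z \in K :\: I by rewrite inE zI.
have [W WN WK] := swap_dep z zKI.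
have /setP/(_ z) : supp X = supp W.
  have [->|->] // := circuit_unique indK XN WN (subset_trans XK (sub _))
                       (subset_trans WK (sub _)).
  by rewrite supp_opp.
rewrite zX => /esym zW; have := subsetP WK z zW; rewrite !inE eqxx /= orbF.
by move=> /eqP ze; rewrite -ze zK in eK.
Qed.

Lemma independent_card_basis I B :
  independent N I -> B \in bases N -> #|I| <= #|B|.
Proof.
move=> indI /basisP[indB maxB]; rewrite leqNgt; apply/negP => ltBI.
have [x] := augmentation indB indI ltBI; rewrite inE => /andP[xB _].
by move=> /maxB/(_ (subsetUr _ _)) E; rewrite -E setU11 in xB.
Qed.

Lemma basis_card B B' : B \in bases N -> B' \in bases N -> #|B| = #|B'|.
Proof.
move=> bB bB'; apply/anti_leq.
by rewrite !independent_card_basis // basis_independent.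
Qed.

Lemma rank_basis B : B \in bases N -> rank N = #|B|.
Proof.
move=> bB; apply/eqP; rewrite eqn_leq; apply/andP; split.
  by apply/bigmax_leqP => J /andP[indJ _]; apply: independent_card_basis.
have indB := basis_independent bB.
by rewrite /rank /rank_of (bigmax_sup B) // indB independent_ground.
Qed.

Lemma circuit_proper_independent X A :
  X \in circuits N -> A \proper supp X -> independent N A.
Proof.
move=> XN /properP[AX [x xX xA]]; apply/independentP; split.
  exact: subset_trans AX (circuit_ground omN XN).
move=> Y YN YA; have YX : supp Y = supp X.
  have [->|->] // := circuit_incomparable omN YN XN (subset_trans YA AX).
  by rewrite supp_opp.
by rewrite -YX in xX; rewrite (subsetP YA x xX) in xA.
Qed.

Lemma fund_circuitP B e : B \in bases N -> e \in ground N :\: B ->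
  [/\ fund_circuit N B e \in circuits N,
      supp (fund_circuit N B e) \subset e |: B
    & fund_circuit N B e e = Some true].
Proof.
case/basisP => indB maxB; rewrite inE => /andP[eB eE].
rewrite /fund_circuit; case: pickP => [X /and3P[XN XB /eqP Xe]|none] //=.
have [||X XN XB] := @dependentP (e |: B).
- by rewrite subUset sub1set eE independent_ground.
- by apply/negP => /maxB/(_ (subsetUr _ _)) E; rewrite -E setU11 in eB.
have : X e != None.
  rewrite -in_supp; apply: contraT => eX.
  case/independentP: indB => _ /(_ X XN); case; apply/subsetP => x xX.
  by have := subsetP XB x xX; rewrite !inE => /orP[/eqP xe|//]; rewrite -xe xX in eX.
case Xe: (X e) => [[]|] // _; first by have := none X; rewrite XN XB Xe eqxx.
suff: false by []; rewrite -(none (opp X)) (circuit_opp omN XN) supp_opp XB.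
by rewrite ffunE Xe.
Qed.

End Matroid.

(** * Existence of fundamental cocircuits *)

Section FundamentalCocircuit.
Variables (T : finType) (N : signed_system T) (I : {set T}) (b : T).
Hypotheses (omN : oriented_matroid N) (bI : b \notin I).
Hypothesis basis_bI : b |: I \in bases N.
Implicit Types (X Y Z D : signed_set T) (J K : {set T}) (e h x : T).

Let H : {set T} := Defs.closure N I.
(** All bases of the hyperplane H, and not only I, are considered: a circuit
    meeting the complement of H need not lie near I, but its part in H extends
    to some basis of H. *)
Let hbasis J := [/\ independent N J, J \subset H & #|J| = #|I|].

Let indI : independent N I.
Proof. exact: independent_sub (basis_independent basis_bI) (subsetUr _ _). Qed.

Let inH e : (e \in H) = (e \in ground N) && ((e \in I) || ~~ independent N (e |: I)).
Proof. by rewrite /H closure_independent // inE. Qed.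

Let subIH : I \subset H.
Proof.
by apply/subsetP => x xI; rewrite inH xI (subsetP (independent_ground indI)).
Qed.

Let bH : b \notin H.
Proof.
by rewrite inH (negPf bI) (basis_independent basis_bI) andbF.
Qed.

Let bE : b \in ground N.
Proof.
exact: (subsetP (independent_ground (basis_independent basis_bI))) (setU11 _ _).
Qed.

Let independent_card_hyperplane K : independent N K -> K \subset H -> #|K| <= #|I|.
Proof.
move=> indK KH; rewrite leqNgt; apply/negP => ltIK.
have [x] := augmentation omN indI indK ltIK; rewrite inE => /andP[xI xK] indxI.
by have := subsetP KH x xK; rewrite inH (negPf xI) indxI andbF.
Qed.

Let hbasis_extension K : independent N K -> K \subset H ->
  exists2 J, hbasis J & K \subset J.
Proof.
move=> indK KH.
have PK : independent N K && (K \subset H) by rewrite indK.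
have [J /maxsetP[/andP[indJ JH] maxJ] KJ] :=
  maxset_exists (P := fun J => independent N J && (J \subset H)) PK.
exists J => //; split=> //; apply/anti_leq.
rewrite independent_card_hyperplane //= leqNgt; apply/negP => ltJI.
have [x] := augmentation omN indJ indI ltJI; rewrite inE => /andP[xJ xI] indxJ.
have E : x |: J = J.
  apply: maxJ; last exact: subsetUr.
  by rewrite indxJ subUset sub1set JH (subsetP subIH).
by rewrite -E setU11 in xJ.
Qed.

Let hbasis_add J e : hbasis J -> e \in ground N :\: H -> independent N (e |: J).
Proof.
case=> indJ JH cardJ; rewrite inE => /andP[eH eE].
have := eH; rewrite inH eE negb_or negbK => /andP[eI indeI].
have lt : #|J| < #|e |: I| by rewrite cardJ cardsU1 eI.
have [x] := augmentation omN indJ indeI lt.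
rewrite !inE => /andP[xJ /orP[/eqP->//|xI]] indxJ.
suff : #|x |: J| <= #|I| by rewrite cardsU1 xJ cardJ add1n ltnn.
apply: independent_card_hyperplane => //.
by rewrite subUset sub1set JH (subsetP subIH).
Qed.

Let hbasis_exchange J J' a : hbasis J -> hbasis J' -> a \in J :\: J' ->
  exists2 a', a' \in J' :\: J & hbasis (a' |: (J :\ a)).
Proof.
case=> indJ JH cardJ [indJ' J'H cardJ']; rewrite inE => /andP[aJ' aJ].
have indJa : independent N (J :\ a) by apply: independent_sub indJ (subD1set _ _).
have lt : #|J :\ a| < #|J'| by rewrite cardJ' -cardJ (cardsD1 a J) aJ.
have [x] := augmentation omN indJa indJ' lt.
rewrite !inE negb_and negbK => /andP[/orP[/eqP xa|xJ] xJ'] ind.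
  by rewrite xa (negPf aJ') in xJ'.
exists x; rewrite ?inE ?xJ //; split=> //.
  by rewrite subUset sub1set (subsetP J'H) //= (subset_trans (subD1set _ _)).
by rewrite cardsU1 !inE (negPf xJ) andbF -cardJ (cardsD1 a J) aJ.
Qed.

(** A circuit cannot leave a flat by a single element; the part of the circuit
    in H is then independent, so it extends to a basis of H, which remains
    independent when e is added. *)
Let circuit_hyperplane X e : X \in circuits N -> e \in ground N :\: H ->
  supp X \subset e |: H -> supp X \subset H.
Proof.
move=> XN eEH XeH; have [eX|eX] := boolP (e \in supp X); last first.
  apply/subsetP => x xX; have := subsetP XeH x xX; rewrite !inE.
  by case/orP => // /eqP xe; rewrite -xe xX in eX.
exfalso.
have indXe : independent N (supp X :\ e).
  by apply: circuit_proper_independent XN _ => //; apply: properD1.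
have XeH' : supp X :\ e \subset H by rewrite subDset.
have [J hJ XJ] := hbasis_extension indXe XeH'.
have /independentP[_ /(_ X XN)] := hbasis_add hJ eEH; apply.
by rewrite -subDset.
Qed.

Let hbasis_circuit J e h : hbasis J -> e \in ground N :\: H ->
    h \in ground N :\: H -> e != h ->
  exists2 X, X \in circuits N & supp X \subset h |: (e |: J).
Proof.
move=> hJ eEH hEH eh; have [indJ JH cardJ] := hJ.
have indeJ := hbasis_add hJ eEH.
have eJ : e \notin J by move: eEH; rewrite inE => /andP[+ _]; apply/contraNN/subsetP.
have hJ' : h \notin J by move: hEH; rewrite inE => /andP[+ _]; apply/contraNN/subsetP.
apply: dependentP.
  by rewrite subUset sub1set independent_ground // andbT; move: hEH; rewrite inE => /andP[].
apply/negP => /(independent_card_basis omN)/(_ basis_bI).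
rewrite !cardsU1 bI eJ !inE negb_or eq_sym eh hJ' cardJ !add1n ltnn //.
Qed.

Let hbasis_circuit_in J e h X : hbasis J -> e \in ground N :\: H ->
    h \in ground N :\: H -> X \in circuits N -> supp X \subset h |: (e |: J) ->
  X e != None /\ X h != None.
Proof.
move=> hJ eEH hEH XN XJ; suff in_k k l : k \in ground N :\: H ->
    supp X \subset l |: (k |: J) -> X l != None.
  by split; [apply: (in_k h); rewrite 1?setUCA | apply: (in_k e)].
move=> kEH {}XJ; rewrite -in_supp; apply: contraT => lX.
have /independentP[_ /(_ X XN)] := hbasis_add hJ kEH; case.
apply/subsetP => x xX; have := subsetP XJ x xX; rewrite in_setU1.
by case/orP => // /eqP xl; rewrite -xl xX in lX.
Qed.

(** Exchange a for a' in J.  If D avoids a, or D' avoids a', then D and D' lie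
    in a common basis plus one element and uniqueness applies.  Otherwise
    assume that D and D' have opposite signs at e and equal signs at h.
    Eliminating e between D and D', and h between D and the opposite of D',
    yields two circuits in J + a', since circuits cannot leave H by a single
    element.  Both have the sign of D at a, but they have opposite signs at a',
    contradicting uniqueness. *)
Let sign_exchange J a a' e h D D' :
    hbasis J -> hbasis (a' |: (J :\ a)) -> a \in J -> a' \notin J ->
    e \in ground N :\: H -> h \in ground N :\: H -> e != h ->
    D \in circuits N -> D' \in circuits N ->
    supp D \subset h |: (e |: J) -> supp D' \subset h |: (e |: (a' |: (J :\ a))) ->
  (D e == D h) = (D' e == D' h).
Proof.
set J' := a' |: _ => hJ hJ' aJ a'J eEH hEH eh DN D'N DJ D'J.
have [indJ JH _] := hJ; have [indJ' J'H _] := hJ'.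
have eH : e \notin H by move: eEH; rewrite inE => /andP[].
have hH : h \notin H by move: hEH; rewrite inE => /andP[].
have aH : a \in H by apply: (subsetP JH).
have a'H : a' \in H by apply: (subsetP J'H); rewrite setU11.
have aa' : a != a' by apply: contraNneq a'J => <-.
have ae : a != e by apply: contraNneq eH => <-.
have ah : a != h by apply: contraNneq hH => <-.
have a'e : a' != e by apply: contraNneq eH => <-.
have a'h : a' != h by apply: contraNneq hH => <-.
have same I0 : independent N (e |: I0) -> supp D \subset h |: (e |: I0) ->
    supp D' \subset h |: (e |: I0) -> (D e == D h) = (D' e == D' h).
  move=> ind DI D'I; have [->|->] // := circuit_unique omN ind DN D'N DI D'I.
  by rewrite !ffunE; case: (D' e) => [[]|]; case: (D' h) => [[]|].
have [aD|aD] := boolP (a \in supp D); last first.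
  apply: (same J' (hbasis_add hJ' eEH)) => //.
  apply/subsetP => x xD; have := subsetP DJ x xD; rewrite !inE.
  have xa : x != a by apply: contraNneq aD => <-.
  by rewrite xa /= => /or3P[] ->; rewrite ?orbT.
have [a'D'|a'D'] := boolP (a' \in supp D'); last first.
  apply: (same J (hbasis_add hJ eEH)) => //.
  apply/subsetP => x xD; have := subsetP D'J x xD; rewrite !inE.
  have xa : x != a' by apply: contraNneq a'D' => <-.
  by rewrite (negPf xa) /= => /or3P[->|->|/andP[_ ->]]; rewrite ?orbT.
have D'a : D' a = None.
  apply/eqP; rewrite -[_ == _]negbK -in_supp; apply/negP => /(subsetP D'J).
  by rewrite !inE (negPf ah) (negPf ae) (negPf aa') eqxx.
have Da' : D a' = None.
  apply/eqP; rewrite -[_ == _]negbK -in_supp; apply/negP => /(subsetP DJ).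
  by rewrite !inE (negPf a'h) (negPf a'e) (negPf a'J).
have [De Dh] := hbasis_circuit_in hJ eEH hEH DN DJ.
have [D'e D'h] := hbasis_circuit_in hJ' eEH hEH D'N D'J.
rewrite in_supp in aD; rewrite in_supp in a'D'.
have [//|diff] := eqVneq (D e == D h) (D' e == D' h); exfalso.
(* D2 stands for D' or its opposite, whichever is opposed to D at e. *)
have main D2 : D2 \in circuits N -> supp D2 = supp D' ->
    D2 e = omap negb (D e) -> D2 h = D h -> False.
  move=> D2N D2D' D2e D2h.
  case Des: (D e) De => [s|] // _; case Dht: (D h) Dh => [t|] // _.
  rewrite Des in D2e; rewrite Dht in D2h.
  have sub_aJ V : V \in circuits N -> V e = None \/ V h = None ->
      (forall x, V x != None -> (D x != None) || (D2 x != None)) ->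
      supp V \subset a' |: J.
    move=> VN Veh VD.
    have VJ x : x \in supp V -> [|| x == h, x == e | x \in a' |: J].
      rewrite in_supp => /VD; rewrite -!in_supp D2D' => /orP[/(subsetP DJ)|/(subsetP D'J)].
        by rewrite !inE => /or3P[] ->; rewrite ?orbT.
      by rewrite !inE => /or4P[->|->|->|/andP[_ ->]]; rewrite ?orbT.
    have aJH x : x \in a' |: J -> x \in H.
      by rewrite in_setU1 => /orP[/eqP->|/(subsetP JH)].
    have VH : supp V \subset H.
      case: Veh => Vk; [apply: (circuit_hyperplane VN hEH) | apply: (circuit_hyperplane VN eEH)];
      apply/subsetP => x xV; case/or3P: (VJ x xV) => [xk|xk|/aJH xH];
      rewrite in_setU1 ?xk ?xH ?orbT //;
      by move: xV; rewrite in_supp (eqP xk) Vk.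
    apply/subsetP => x xV; have xH := subsetP VH x xV.
    by case/or3P: (VJ x xV) => [/eqP xk|/eqP xk|//]; move: eH hH; rewrite -xk xH.
  have [|||||Z [ZN Ze ZD]] := @circuit_elim _ N omN D D2 e s => //.
    apply/eqP => /ffunP/(_ h); rewrite ffunE D2h Dht => -[].
    by case: (t).
  have [|||||W [WN Wh WD]] := @circuit_elim _ N omN D (opp D2) h t => //.
  - exact: circuit_opp.
  - by apply/eqP => /ffunP/(_ e); rewrite oppK D2e Des => -[]; case: (s).
  - by rewrite ffunE D2h.
  have Zsub : supp Z \subset a' |: J.
    apply: sub_aJ => // [|x]; first by left.
    by case Zx: (Z x) => [c|] // _; case: (ZD x c Zx) => ->; rewrite ?orbT.
  have Wsub : supp W \subset a' |: J.
    apply: sub_aJ => // [|x]; first by right.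
    case Wx: (W x) => [c|] // _; have [->//|] := WD x c Wx.
    by rewrite ffunE; case: (D2 x) => [d|] //; rewrite orbT.
  have in_a V : V \in circuits N -> supp V \subset a' |: J -> V a != None.
    move=> VN VJ; rewrite -in_supp; apply: contraT => aV.
    case/independentP: indJ' => _ /(_ V VN); case; apply/subsetP => x xV.
    have := subsetP VJ x xV; rewrite !inE.
    by have -> : x != a by apply: contraNneq aV => <-.
  have in_a' V : V \in circuits N -> supp V \subset a' |: J -> V a' != None.
    move=> VN VJ; rewrite -in_supp; apply: contraT => a'V.
    case/independentP: indJ => _ /(_ V VN); case; apply/subsetP => x xV.
    have := subsetP VJ x xV; rewrite !inE => /orP[/eqP xa'|//].
    by rewrite -xa' xV in a'V.
  have D2a : D2 a = None.
    by apply/eqP; rewrite -[_ == _]negbK -in_supp D2D' in_supp D'a.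
  have Za : Z a = D a.
    case Za: (Z a) (in_a Z ZN Zsub) => [c|] // _.
    by case: (ZD a c Za) => [->//|]; rewrite D2a.
  have Za' : Z a' = D2 a'.
    case Za': (Z a') (in_a' Z ZN Zsub) => [c|] // _.
    by case: (ZD a' c Za') => [|->//]; rewrite Da'.
  have Wa : W a = D a.
    case Wa: (W a) (in_a W WN Wsub) => [c|] // _.
    by case: (WD a c Wa) => [->//|]; rewrite ffunE D2a.
  have Wa' : W a' = opp D2 a'.
    case Wa': (W a') (in_a' W WN Wsub) => [c|] // _.
    by case: (WD a' c Wa') => [|->//]; rewrite Da'.
  have D2a' : D2 a' != None by rewrite -in_supp D2D' in_supp.
  have [ZW|ZW] := circuit_unique omN indJ ZN WN Zsub Wsub.
    by move: Wa'; rewrite -ZW Za' ffunE; case: (D2 a') D2a' => [[]|].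
  by move: Za; rewrite ZW ffunE Wa; case: (D a) aD => [[]|].
have main' := main _ (circuit_opp omN D'N) (supp_opp _).
move: {main}(main D' D'N erefl) main' diff De Dh D'e D'h; rewrite !ffunE.
by case: (D e) => [[]|]; case: (D h) => [[]|]; case: (D' e) => [[]|];
  case: (D' h) => [[]|] //= m1 m2 _ _ _ _ _; solve [exact: m1 | exact: m2].
Qed.


Let sign_consistent J J' e h D D' : hbasis J -> hbasis J' ->
    e \in ground N :\: H -> h \in ground N :\: H -> e != h ->
    D \in circuits N -> D' \in circuits N ->
    supp D \subset h |: (e |: J) -> supp D' \subset h |: (e |: J') ->
  (D e == D h) = (D' e == D' h).
Proof.
move=> hJ hJ' eEH hEH eh DN D'N DJ D'J.
have [n] := ubnP #|J :\: J'|; elim: n => // n IHn in J D hJ DN DJ *.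
move=> ltn; have [/eqP|[a aJJ']] := set_0Vmem (J :\: J').
  rewrite setD_eq0 => JJ'; have [indJ' _ _] := hJ'.
  have [->|->] // :=
    circuit_unique omN (hbasis_add hJ' eEH) DN D'N
      (subset_trans DJ (setUS _ (setUS _ JJ'))) D'J.
  by rewrite !ffunE; case: (D' e) => [[]|]; case: (D' h) => [[]|].
have [a' a'J'J hJ1] := hbasis_exchange hJ hJ' aJJ'.
have [D1 D1N D1J] := hbasis_circuit hJ1 eEH hEH eh.
move: (aJJ') a'J'J; rewrite !inE => /andP[aJ' aJ] /andP[a'J a'J'].
rewrite (sign_exchange hJ hJ1 aJ a'J eEH hEH eh DN D1N DJ D1J).
apply: IHn hJ1 D1N D1J _.
rewrite ltnS in ltn; apply: leq_trans ltn; apply: proper_card.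
apply/properP; split; last by exists a; rewrite ?aJJ' // !inE eqxx ?andbF //
  orbF negb_and; apply/orP; right; apply: contraNneq a'J => <-.
apply/subsetP => x; rewrite !inE => /andP[xJ' /orP[/eqP xa'|/andP[_ ->]]].
  by rewrite xa' a'J' in xJ'.
by rewrite xJ'.
Qed.

Let hI : hbasis I.
Proof. by split. Qed.

Let bEH : b \in ground N :\: H.
Proof. by rewrite inE bH bE. Qed.

(* The sign of e is forced by orthogonality to the fundamental circuit of e
    with respect to the basis, which meets the cocircuit in b and e only. *)
Let coc : signed_set T :=
  [ffun e => if e \in ground N :\: H then
     Some ((e == b) || ~~ [exists X in circuits N,
             (supp X \subset e |: (b |: I)) && (X b == X e)])
   else None].

Let supp_coc : supp coc = ground N :\: H.
Proof. by apply/setP => x; rewrite in_supp ffunE; case: ifP. Qed.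

Let coc_b : coc b = Some true.
Proof. by rewrite ffunE bEH eqxx. Qed.

Let coc_circuit J e D : hbasis J -> e \in ground N :\: H -> e != b ->
    D \in circuits N -> supp D \subset e |: (b |: J) ->
  (D b == D e) = (coc b != coc e).
Proof.
move=> hJ eEH eb DN DJ; rewrite coc_b ffunE eEH (negPf eb) /=.
have be : b != e by rewrite eq_sym.
have -> : [exists X in circuits N,
             (supp X \subset e |: (b |: I)) && (X b == X e)] = (D b == D e).
  apply/exists_inP/idP => [[X XN /andP[XI XE]]|DE].
    by rewrite -(sign_consistent hI hJ bEH eEH be XN DN XI DJ).
  have [X XN XI] := hbasis_circuit hI bEH eEH be.
  by exists X => //; rewrite XI (sign_consistent hI hJ bEH eEH be XN DN XI DJ).
by case: (D b == D e).
Qed.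

(** Induction on the number of elements of X outside H other than b: while
    there is such an element e, it can be eliminated against a fundamental
    circuit.  Without one, X would leave H by b only. *)
Let coc_not_agree X : X \in circuits N ->
    (exists x, (x \in supp X) && (x \in supp coc)) ->
  ~ (forall x, x \in supp X -> x \in supp coc -> X x = coc x).
Proof.
have [n] := ubnP #|(supp X :\: H) :\ b|; elim: n => // n IHn in X *.
move=> ltn XN [x0 /andP[x0X x0Y]] agree; rewrite supp_coc in x0Y.
have XE := circuit_ground omN XN.
have indXH : independent N (supp X :&: H).
  apply: (circuit_proper_independent omN XN); apply/properP; split.
    exact: subsetIl.
  by exists x0 => //; move: x0Y; rewrite in_setD in_setI negb_and => /andP[-> _]; rewrite orbT.
have [J hJ XJ] := hbasis_extension indXH (subsetIr _ _).
have [indJ JH _] := hJ.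
have [X0|[e]] := set_0Vmem ((supp X :\: H) :\ b).
  have : supp X \subset H.
    apply: (circuit_hyperplane XN bEH); apply/subsetP => x xX.
    move/setP/(_ x): X0; rewrite in_setD1 in_setD in_set0 xX andbT => /negbT.
    by rewrite negb_and !negbK in_setU1.
  by move/subsetP/(_ x0 x0X) => x0H; move: x0Y; rewrite inE x0H.
rewrite in_setD1 in_setD => /and3P[eb eH eX].
have eEH : e \in ground N :\: H by rewrite inE eH (subsetP XE).
have be : b != e by rewrite eq_sym.
have [s Xe] : exists s, X e = Some s.
  by move: eX; rewrite in_supp; case: (X e) => [s|] // _; exists s.
have [D [DN DJ De]] : exists D, [/\ D \in circuits N,
    supp D \subset e |: (b |: J) & D e = Some (~~ s)].
  have [D DN DJ] := hbasis_circuit hJ bEH eEH be.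
  have [_ De] := hbasis_circuit_in hJ bEH eEH DN DJ.
  case Des: (D e) De => [t|] // _.
  have [ts|ts] := eqVneq t (~~ s); first by exists D; rewrite Des ts.
  exists (opp D); rewrite supp_opp circuit_opp // ffunE Des; split=> //=.
  by case: t s ts {Xe Des} => [] [].
have [Db _] := hbasis_circuit_in hJ bEH eEH DN DJ.
have coc_e : coc e = Some s by rewrite -agree // supp_coc.
(* D and coc are opposed at e, hence they agree at b by the choice of coc. *)
have Db_coc : D b = coc b.
  have := coc_circuit hJ eEH eb DN DJ; rewrite De coc_e coc_b.
  by case: (D b) Db => [[]|] //; case: (s).
have XD : X != opp D.
  apply: contraTneq isT => XD.
  have XJb : supp X \subset e |: (b |: J) by rewrite XD supp_opp.
  have := coc_circuit hJ eEH eb XN XJb.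
  have [Xb _] := hbasis_circuit_in hJ bEH eEH XN XJb.
  rewrite -!agree ?supp_coc //; first by case: (X b == X e).
  by rewrite in_supp.
have [Z [ZN Ze ZXD]] := circuit_elim omN XN DN XD Xe De.
have Zagree x : x \in supp Z -> x \in supp coc -> Z x = coc x.
  rewrite in_supp; case Zx: (Z x) => [c|] // _ xY.
  case: (ZXD x c Zx) => xc; first by rewrite -agree // in_supp xc.
  have : x \in supp D by rewrite in_supp xc.
  move/(subsetP DJ); rewrite !in_setU1 => /or3P[/eqP xe|/eqP xb|/(subsetP JH) xH].
  - by rewrite xe Ze in Zx.
  - by rewrite xb -Db_coc -xb xc.
  - by move: xY; rewrite supp_coc inE xH.
have Zsub x : x \in supp Z -> x \notin H -> x != b -> (x \in supp X) && (x != e).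
  rewrite in_supp; case Zx: (Z x) => [c|] // _ xH xb.
  have xe : x != e by apply: contraTneq isT => xe; rewrite xe Ze in Zx.
  rewrite xe andbT; case: (ZXD x c Zx) => xc; first by rewrite in_supp xc.
  have : x \in supp D by rewrite in_supp xc.
  move/(subsetP DJ); rewrite !in_setU1 (negPf xe) (negPf xb) /=.
  by move/(subsetP JH); rewrite (negPf xH).
apply: (IHn Z) => //.
  rewrite ltnS in ltn; apply: leq_trans ltn; apply: proper_card.
  apply/properP; split.
    apply/subsetP => x; rewrite !in_setD1 !in_setD => /and3P[xb xH xZ].
    by rewrite xb xH; case/andP: (Zsub x xZ xH xb).
  by exists e; rewrite !in_setD1 !in_setD ?eb ?eH ?eX // in_supp Ze.
(* Otherwise Z lies in H; its part there comes from X or D, hence is in J. *)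
have [/existsP //|/existsPn none] :=
  boolP [exists x, (x \in supp Z) && (x \in supp coc)].
case/independentP: indJ => _ /(_ Z ZN) []; apply/subsetP => x xZ.
have := none x; rewrite xZ supp_coc inE (subsetP (circuit_ground omN ZN)) //.
rewrite andbT negbK => xH; move: xZ; rewrite in_supp.
case Zx: (Z x) => [c|] // _; case: (ZXD x c Zx) => xc.
  by apply: (subsetP XJ); rewrite inE in_supp xc.
have : x \in supp D by rewrite in_supp xc.
move/(subsetP DJ); rewrite !in_setU1 => /or3P[/eqP xe|/eqP xb|//].
  by rewrite -xe xH in eH.
by move: bH; rewrite -xb xH.
Qed.

Let coc_orthogonal X : X \in circuits N -> orthogonal X coc.
Proof.
move=> XN; have [X0|[x xX]] := set_0Vmem (supp X :&: supp coc).
  by rewrite /orthogonal X0 eqxx.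
rewrite inE in xX; apply: contraT => nXY.
have ex : exists x, (x \in supp X) && (x \in supp coc) by exists x.
case: (not_orthogonal_agree ex nXY) => agree; first by case: (coc_not_agree XN ex).
have := coc_not_agree (circuit_opp omN XN); rewrite supp_opp.
by case/(_ ex).
Qed.

(** The support is minimal: if a vector orthogonal to all circuits were
    supported on a smaller set, containing y but not x, it would meet the
    circuit in I + x + y at y only. *)
Lemma cocircuit_closure_exists :
  exists2 Y, Y \in cocircuits N &
    (supp Y == ground N :\: Defs.closure N I) && (Y b == Some true).
Proof.
exists coc; last by rewrite supp_coc coc_b !eqxx.
rewrite inE; apply/and3P; split.
- rewrite inE supp_coc subsetDl; apply/forall_inP; exact: coc_orthogonal.
- by apply/set0Pn; exists b; rewrite supp_coc.
apply/forall_inP => Y; rewrite inE => /andP[YE /forall_inP orthY].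
apply/implyP => /set0Pn[y yY]; apply/negP => /properP[Ycoc [x xcoc xY]].
have xEH : x \in ground N :\: H by rewrite -supp_coc.
have yEH : y \in ground N :\: H by rewrite -supp_coc (subsetP Ycoc).
have xy : x != y by apply: contraNneq xY => ->.
have [X XN XI] := hbasis_circuit hI xEH yEH xy.
have [_ Xy] := hbasis_circuit_in hI xEH yEH XN XI.
have := orthogonal_supp_neq1 y (orthY X XN); case/eqP; apply/setP => z.
rewrite in_setI in_set1; apply/andP/eqP => [[zX zY]|->]; last by rewrite in_supp.
have := subsetP XI z zX; rewrite !in_setU1 => /or3P[/eqP//|/eqP zx|zI].
  by rewrite -zx zY in xY.
by have := subsetP Ycoc z zY; rewrite supp_coc inE (subsetP subIH).
Qed.

End FundamentalCocircuit.

(** * Cocircuits and closures *)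

Section Cocircuits.
Variables (T : finType) (N : signed_system T).
Implicit Types (Y : signed_set T) (B I : {set T}) (b e : T).

Lemma fund_cocircuitP B b :
    oriented_matroid N -> B \in bases N -> b \in B ->
  fund_cocircuit N B b \in cocircuits N /\
  supp (fund_cocircuit N B b) = ground N :\: Defs.closure N (B :\ b).
Proof.
move=> omN bB Bb; have bI : b \notin B :\ b by rewrite !inE eqxx.
have bIB : b |: (B :\ b) \in bases N by rewrite setD1K.
have [Y YN YP] := cocircuit_closure_exists omN bI bIB.
rewrite /fund_cocircuit; case: pickP => [Z /and3P[ZN /eqP Zsupp _]|none] //=.
by suff: false by []; rewrite -(none Y) YN.
Qed.

Lemma cocircuit_orthogonal X Y :
  X \in circuits N -> Y \in cocircuits N -> orthogonal X Y.
Proof.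
move=> XN; rewrite inE => /andP[]; rewrite inE => /andP[_ /forall_inP orthY] _.
exact: orthY.
Qed.

Lemma cocircuit_ground Y : Y \in cocircuits N -> supp Y \subset ground N.
Proof. by rewrite inE => /andP[]; rewrite inE => /andP[]. Qed.

Lemma disjoint_cocircuit_closure I Y : independent N I ->
    Y \in cocircuits N -> [disjoint I & supp Y] ->
  [disjoint Defs.closure N I & supp Y].
Proof.
move=> indI YN IY; apply/pred0P => e /=; apply/negP => /andP[+ eY].
have eI : e \notin I by apply: contraL eY => eI; rewrite (disjointFr IY eI).
rewrite closure_independent // inE (negPf eI) => /andP[eN dep].
have [|X XN XI] := dependentP _ dep.
  by rewrite subUset sub1set eN independent_ground.
have := orthogonal_supp_neq1 e (cocircuit_orthogonal XN YN).
case/eqP; apply/setP => x; rewrite in_setI in_set1.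
apply/andP/eqP => [[xX xY]|->].
  have := subsetP XI x xX; rewrite in_setU1 => /orP[/eqP//|xI].
  by rewrite (disjointFr IY xI) in xY.
split=> //; apply: contraT => eX.
case/independentP: indI => _ /(_ X XN) []; apply/subsetP => z zX.
have := subsetP XI z zX; rewrite in_setU1 => /orP[/eqP ze|//].
by rewrite -ze zX in eX.
Qed.

End Cocircuits.

(** * Deletion and contraction *)

Section Minors.
Variables (T : finType) (N : signed_system T).
Implicit Types (X : signed_set T) (A B : {set T}) (e f g : T).

Lemma independent_deletion f A :
  independent (deletion N f) A = (f \notin A) && independent N A.
Proof.
apply/independentP/andP => [[]|[fA /independentP[AN h]]].
  rewrite subsetD1 => /andP[AN fA] h; split=> //; apply/independentP; split=> //.
  move=> X XN XA; apply: (h X) => //; rewrite inE XN.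
  by apply: contra fA; apply: (subsetP XA).
rewrite subsetD1 AN; split=> // X; rewrite inE => /andP[XN _]; exact: h.
Qed.

(** The circuits of the contraction are minimal, so every circuit of N other
    than [set g] contains, off g, one of them; for g no loop this makes
    minimality invisible. *)
Lemma independent_contraction g A : independent N [set g] ->
  independent (contraction N g) A = (g \notin A) && independent N (g |: A).
Proof.
move=> indg; have gN : g \in ground N by rewrite -sub1set independent_ground.
apply/independentP/andP => [[]|[gA /independentP[]]].
  rewrite subsetD1 => /andP[AN gA] h; split=> //; apply/independentP; split.
    by rewrite subUset sub1set gN.
  move=> X XN XA; pose S := [set remove [set g] W | W in circuits N].
  have XS : remove [set g] X \in S by apply/imsetP; exists X.
  have [|Z ZS ZX] := min_supp_exists XS.
    rewrite supp_remove1 setD_eq0; apply/negP => Xg.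
    by case/independentP: indg => _ /(_ X XN).
  apply: (h Z) => //; apply: subset_trans ZX _.
  by rewrite supp_remove1 subDset.
rewrite subUset => /andP[_ AN] h; rewrite subsetD1 AN; split=> // Z.
rewrite inE => /andP[/imsetP[X XN ->] _]; rewrite supp_remove1 subDset.
exact: h.
Qed.

Lemma basis_contraction g B : independent N [set g] ->
  (B \in bases (contraction N g)) = (g \notin B) && (g |: B \in bases N).
Proof.
move=> indg; apply/basisP/andP => [[]|[gB /basisP[indB maxB]]].
  rewrite independent_contraction // => /andP[gB indB] maxB.
  split=> //; apply/basisP; split=> // A indA BA.
  have gA : g \in A by apply: (subsetP BA); rewrite setU11.
  have <- : A :\ g = B; last by rewrite setD1K.
  apply: maxB; first by rewrite independent_contraction // setD1K // !inE eqxx.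
  by rewrite subsetD1 gB andbT; apply: subset_trans (subsetUr _ _) BA.
split; first by rewrite independent_contraction // gB.
move=> A; rewrite independent_contraction // => /andP[gA indA] BA.
have := maxB _ indA (setUS _ BA) => /(congr1 (fun C => C :\ g)).
by rewrite !setU1K.
Qed.

Lemma independent0_contraction g : independent (contraction N g) set0.
Proof.
apply/independentP; split=> [|X]; first exact: sub0set.
rewrite inE => /and3P[_ X0 _]; rewrite subset0; exact/negP.
Qed.

Lemma basis_exists A : independent N A -> exists2 B, B \in bases N & A \subset B.
Proof.
by move/maxset_exists => [B maxB AB]; exists B => //; rewrite inE.
Qed.

End Minors.

(** * Generic extension-liftings *)

(** A basis of the deletion of f stays maximal since genericity makes it a
    circuit once f is added. *)
Lemma basis_generic_extension (T : finType) (N : signed_system T) f B :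
    generic_extension (deletion N f) f N ->
  B \in bases (deletion N f) -> B \in bases N.
Proof.
case=> _ /setP/(_ (f |: B)) + bB; rewrite imset_f // => /imsetP[X].
rewrite inE => /andP[XN _] XB.
case/basisP: bB; rewrite independent_deletion => /andP[fB indB] maxB.
apply/basisP; split=> // A indA BA; apply: maxB => //.
rewrite independent_deletion indA andbT; apply/negP => fA.
case/independentP: indA => _ /(_ X XN) []; rewrite -XB.
by rewrite subUset sub1set fA.
Qed.

Section GenericExtensionLifting.
Variables (T : finType) (M Mbar : signed_system T) (f g : T).
Hypotheses (fg : f != g) (fM : f \notin ground M) (gM : g \notin ground M).
Hypothesis gel : generic_extension_lifting M f g Mbar.
Implicit Types (Y : signed_set T) (B : {set T}).

Let omMbar : oriented_matroid Mbar. Proof. by case: gel. Qed.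

(** The contraction has a basis, so genericity provides a cocircuit through g,
    and a circuit meets no cocircuit in a single element. *)
Lemma lifting_element_nonloop : independent Mbar [set g].
Proof.
have [_ gr _ _ [_ /setP coc]] := gel.
have [B bB _] := basis_exists (independent0_contraction Mbar g).
have := coc (g |: (ground (contraction Mbar g) :\: B)).
rewrite [RHS]imset_f // => /imsetP[Y]; rewrite inE => /andP[YN gY] _.
apply/independentP; split; first by rewrite sub1set gr !inE eqxx !orbT.
move=> X XN; rewrite subset1 => /orP[/eqP Xg|]; last first.
  exact/negP/(circuit_nonempty omMbar).
have := orthogonal_supp_neq1 g (cocircuit_orthogonal XN YN).
by rewrite Xg (setIidPl _) ?eqxx // sub1set.
Qed.
Let indg := lifting_element_nonloop.

(** A basis of M together with g is maximal among the independent sets of Mbar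
    avoiding f, and such sets are bases of Mbar by genericity. *)
Lemma basis_base_matroid B :
  (B \in bases M) = [&& f \notin B, g \notin B & g |: B \in bases Mbar].
Proof.
have [_ _ defM gext _] := gel.
have indM A : independent M A =
    [&& f \notin A, g \notin A & independent Mbar (g |: A)].
  by rewrite -defM independent_deletion independent_contraction.
apply/basisP/and3P => [[]|[fB gB /basisP[indB maxB]]].
  rewrite indM => /and3P[fB gB indB] maxB; split=> //.
  apply: (basis_generic_extension gext); apply/basisP.
  rewrite independent_deletion indB !inE negb_or fg fB; split=> // A.
  rewrite independent_deletion => /andP[fA indA] BA.
  have gA : g \in A by apply: (subsetP BA); rewrite setU11.
  have <- : A :\ g = B; last by rewrite setD1K.
  apply: maxB; first by rewrite indM setD1K // !inE eqxx (negPf fA) andbF.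
  by rewrite subsetD1 gB andbT; apply: subset_trans (subsetUr _ _) BA.
split; first by rewrite indM fB gB.
move=> A; rewrite indM => /and3P[fA gA indA] BA.
have := maxB _ indA (setUS _ BA) => /(congr1 (fun C => C :\ g)).
by rewrite !setU1K.
Qed.

Lemma basis_sub_ground B : B \in bases M -> B \subset ground M.
Proof. by move/basis_independent/independent_ground. Qed.

Lemma vertex_supp B : B \subset ground M ->
  ground Mbar :\: B = (ground M :\: B) :|: [set f; g].
Proof.
have [_ -> _ _ _] := gel => /subsetP BM.
have fB : f \notin B by apply: contra fM; apply: BM.
have gB : g \notin B by apply: contra gM; apply: BM.
apply/setP => x; rewrite !inE; have [->|_] := eqVneq x f; first by rewrite fB !orbT.
have [->|_] := eqVneq x g; first by rewrite gB !orbT.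
by rewrite !orbF.
Qed.

Lemma vertex_of_basis B : B \in bases M ->
  exists2 Y, Y \in cocircuits Mbar & supp Y = ground Mbar :\: B.
Proof.
have [_ gr _ _ [_ /setP coc]] := gel.
rewrite basis_base_matroid => /and3P[fB gB bB].
have := coc (g |: (ground (contraction Mbar g) :\: B)).
rewrite [RHS]imset_f; last by rewrite basis_contraction // gB.
case/imsetP=> Y; rewrite inE => /andP[YN gY] YE; exists Y => //; rewrite -YE.
apply/setP => x; rewrite !inE; have [->|//] := eqVneq x g.
by rewrite gB gr !inE eqxx !orbT.
Qed.

Lemma basis_of_vertex Y : Y \in cocircuits Mbar ->
  f \in supp Y -> g \in supp Y -> ground Mbar :\: supp Y \in bases M.
Proof.
have [_ gr _ _ [_ /setP coc]] := gel => YN fY gY.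
have := coc (supp Y); rewrite imset_f; last by rewrite inE YN.
move/esym/imsetP => [B bB YB].
have := basis_sub_ground; rewrite basis_base_matroid.
have := bB; rewrite basis_contraction // => /andP[gB bgB].
have -> : ground Mbar :\: supp Y = B.
  have /subsetP BN := independent_ground (basis_independent bB).
  rewrite YB; apply/setP => x; rewrite !inE.
  have [->|xg] /= := eqVneq x g; first by rewrite (negPf gB).
  have [xB|xB] := boolP (x \in B).
    by move: (BN x xB); rewrite !inE xg.
  by rewrite andNb.
rewrite gB bgB !andbT => _.
by move: fY; rewrite YB !inE (negPf fg) /= => /andP[].
Qed.

(** The cocircuit complementary to a basis of M witnesses that the basis is
    closed in Mbar. *)
Lemma closure_base_basis B : B \in bases M -> Defs.closure Mbar B = B.
Proof.
move=> bB; have [Y YN YB] := vertex_of_basis bB.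
have indB : independent Mbar B.
  move: bB; rewrite basis_base_matroid => /and3P[_ _ /basis_independent].
  by move/independent_sub; apply; apply: subsetUr.
have BY : [disjoint B & supp Y].
  by rewrite YB -setI_eq0 setIDA setIC -setIDA setDv setI0.
have := disjoint_cocircuit_closure indB YN BY => clY.
apply/setP => e; apply/idP/idP => [ecl|eB]; last first.
  by rewrite closure_independent // inE eB (subsetP (independent_ground indB)).
have := disjointFr clY ecl; rewrite YB in_setD.
by move: ecl; rewrite inE => /andP[-> _]; rewrite andbT => /negbFE.
Qed.

Lemma vertex_basis_bijection :
  bijection_between (fun B : {set T} => (ground M :\: B) :|: [set f; g])
    (bases M)
    [set supp Y | Y in cocircuits Mbar & (f \in supp Y) && (g \in supp Y)].
Proof.
have [_ gr _ _ _] := gel.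
split=> [B B' bB bB'|].
  rewrite -!vertex_supp ?basis_sub_ground // => E.
  have sub A : A \in bases M -> A = ground Mbar :\: (ground Mbar :\: A).
    move=> bA; rewrite setDDr setDv set0U; apply/esym/setIidPr.
    by rewrite gr; apply: subset_trans (basis_sub_ground bA) (subsetUl _ _).
  by rewrite (sub B) // E -sub.
apply/setP => S; apply/imsetP/imsetP => [[B bB ->]|[Y]].
  have [Y YN YB] := vertex_of_basis bB; exists Y; last first.
    by rewrite YB vertex_supp // basis_sub_ground.
  by rewrite inE YN YB vertex_supp ?basis_sub_ground // !inE !eqxx !orbT.
rewrite inE => /and3P[YN fY gY] ->; have bB := basis_of_vertex YN fY gY.
exists (ground Mbar :\: supp Y) => //.
rewrite -vertex_supp ?basis_sub_ground // setDDr setDv set0U.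
by apply/esym/setIidPr/cocircuit_ground.
Qed.

Lemma basis_add_bijection :
  bijection_between (fun B : {set T} => B :|: [set g]) (bases M)
    [set B in bases Mbar | (g \in B) && (f \notin B)].
Proof.
split=> [B B'|].
  rewrite !basis_base_matroid => /and3P[_ gB _] /and3P[_ gB' _] /=.
  by rewrite ![_ :|: [set g]]setUC => /(congr1 (fun C => C :\ g)); rewrite !setU1K.
apply/setP => A; rewrite inE; apply/imsetP/and3P => [[B + ->]|[bA gA fA]].
  rewrite basis_base_matroid => /and3P[fB gB bB].
  by rewrite setUC bB !inE eqxx (negPf fg).
exists (A :\ g); last by rewrite setUC setD1K.
by rewrite basis_base_matroid setD1K // bA !in_setD1 eqxx (negPf fA) andbF.
Qed.

Lemma fund_cocircuit_lifting B : B \in bases M ->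
  fund_cocircuit Mbar (B :|: [set g]) g \in cocircuits Mbar /\
  supp (fund_cocircuit Mbar (B :|: [set g]) g) =
    (ground M :\: B) :|: [set f; g].
Proof.
move=> bB; have := bB; rewrite basis_base_matroid => /and3P[_ gB bgB]; rewrite setUC.
have [YN ->] := fund_cocircuitP omMbar bgB (setU11 _ _); split=> //.
by rewrite setU1K // closure_base_basis // vertex_supp // basis_sub_ground.
Qed.

(** This is what spanning means for circuits through f, transferred from the
    deletion of f to Mbar itself. *)
Lemma extension_circuit_spanning X : X \in circuits Mbar -> f \in supp X ->
  exists2 B, B \in bases Mbar & f \notin B /\ supp X = f |: B.
Proof.
have [_ _ _ gext _] := gel => XN fX; have [_ /setP/(_ (supp X))] := gext.
rewrite imset_f; last by rewrite inE XN.
case/esym/imsetP => B bB XB; exists B; last split=> //.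
  exact: basis_generic_extension gext bB.
by have := basis_independent bB; rewrite independent_deletion => /andP[].
Qed.

End GenericExtensionLifting.

Theorem proposition1 (T : finType) (M Mbar : signed_system T) (r : nat)
    (f g : T) (hM : oriented_matroid M) (hr : rank M = r)
    (hfg : f != g) (hf : f \notin ground M) (hg : g \notin ground M)
    (hMbar : generic_extension_lifting M f g Mbar) :
  (* (i) *)
  (forall Y : signed_set T, Y \in cocircuits Mbar ->
     f \in supp Y -> g \in supp Y ->
     #|ground Mbar :\: supp Y| = r /\ ground Mbar :\: supp Y \in bases M)
  /\
  (* (ii) *)
  bijection_between (fun B : {set T} => (ground M :\: B) :|: [set f; g])
    (bases M)
    [set supp Y | Y in cocircuits Mbar & (f \in supp Y) && (g \in supp Y)]
  /\
  (* (iii) *)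
  (bijection_between (fun B : {set T} => B :|: [set g])
     (bases M)
     [set B in bases Mbar | (g \in B) && (f \notin B)]
   /\
   (forall B : {set T}, B \in bases M ->
      fund_cocircuit Mbar (B :|: [set g]) g \in cocircuits Mbar /\
      supp (fund_cocircuit Mbar (B :|: [set g]) g)
        = (ground M :\: B) :|: [set f; g])
   /\
   [set supp (fund_cocircuit Mbar B g)
      | B in [set B in bases Mbar | (g \in B) && (f \notin B)]]
   = [set supp Y | Y in cocircuits Mbar & (f \in supp Y) && (g \in supp Y)])
  /\
  (* (iv) *)
  (forall B : {set T}, B :|: [set g] \in bases Mbar ->
     g \notin B -> f \notin B ->
     [/\ forall b, b \in B ->
           f \in supp (fund_cocircuit Mbar (B :|: [set g]) b),
         forall e, e \in ground M :\: B ->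
           g \in supp (fund_circuit Mbar (B :|: [set g]) e)
       & supp (fund_circuit Mbar (B :|: [set g]) f) = B :|: [set f; g]]).
Proof.
have [omN gr _ _ _] := hMbar.
have vertex_bij := vertex_basis_bijection hfg hf hg hMbar.
have add_bij := basis_add_bijection hfg hMbar.
have fund_g := fund_cocircuit_lifting hfg hf hg hMbar.
split=> [Y YN fY gY|].
  have bY := basis_of_vertex hfg hMbar YN fY gY; split=> //.
  by rewrite -hr (rank_basis hM bY).
split=> //; split; first (do 2!split=> //).
  rewrite -(proj2 add_bij) -(proj2 vertex_bij) -imset_comp.
  by apply: eq_in_imset => B /fund_g[].
move=> B; rewrite setUC => bgB gB fB.
have bB : B \in bases M by rewrite (basis_base_matroid hfg hMbar) fB gB.
have indgB := basis_independent bgB.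
have fNg : f \in ground Mbar by rewrite gr !inE eqxx orbT.
(* A circuit through f spans, so it is too large to lie in f |: A for a
   proper subset A of a basis. *)
have spanning (A : {set T}) X : A \subset g |: B -> X \in circuits Mbar -> f \in supp X ->
    supp X \subset f |: A -> A = g |: B /\ supp X = f |: A.
  move=> AB XN fX XA.
  have [B' bB' [fB' XB']] := extension_circuit_spanning hMbar XN fX.
  have BA : B' \subset A.
    apply/subsetP => x xB'; have : x \in f |: A.
      by apply: (subsetP XA); rewrite XB' in_setU1 xB' orbT.
    by rewrite in_setU1 => /orP[/eqP xf|//]; rewrite -xf xB' in fB'.
  have B'E : B' = g |: B.
    apply/eqP; rewrite eqEcard (subset_trans BA AB).
    by rewrite (basis_card omN bB' bgB) leqnn.
  have AE : A = g |: B by apply/eqP; rewrite eqEsubset AB -B'E BA.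
  by rewrite XB' B'E AE.
split=> [b bB'|e|].
- have bgBb : b \in g |: B by rewrite in_setU1 bB' orbT.
  have [_ ->] := fund_cocircuitP omN bgB bgBb.
  have fgB : f \notin g |: B by rewrite in_setU1 negb_or hfg.
  rewrite inE fNg andbT closure_independent; last first.
    exact: independent_sub indgB (subD1set _ _).
  rewrite inE fNg in_setD1 (negPf fgB) andbF /= negbK; apply: contraT => dep.
  have [|X XN XA] := dependentP _ dep.
    rewrite subUset sub1set fNg; apply: subset_trans (subD1set _ _) _.
    exact: independent_ground.
  have fX : f \in supp X.
    apply: contraT => fX; case/independentP: indgB => _ /(_ X XN) [].
    apply/subsetP => x xX; have := subsetP XA x xX; rewrite in_setU1 in_setD1.
    by case/orP => [/eqP xf|/andP[]//]; rewrite -xf xX in fX.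
  have [/setP/(_ b)] := spanning _ _ (subD1set _ b) XN fX XA.
  by rewrite in_setD1 eqxx bgBb.
- rewrite inE => /andP[eB eM].
  have eN : e \in ground Mbar :\: (g |: B).
    rewrite in_setD in_setU1 negb_or eB gr in_setU eM !andbT /=.
    by apply: contraNneq hg => <-.
  have [XN XB Xe] := fund_circuitP omN bgB eN.
  apply: contraT => gX; move: (closure_base_basis hfg hMbar bB) => clB.
  suff : e \in Defs.closure Mbar B by rewrite clB (negPf eB).
  rewrite closure_independent; last exact: independent_sub indgB (subsetUr _ _).
  rewrite inE (negPf eB) gr in_setU eM /=; apply/independentP => -[_ /(_ _ XN)[]].
  apply/subsetP => x xX; have := subsetP XB x xX; rewrite !in_setU1.
  by case/or3P => [->//|/eqP xg|->]; rewrite ?orbT //; rewrite xg (negPf gX) in xX.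
have fN : f \in ground Mbar :\: (g |: B) by rewrite in_setD in_setU1 negb_or hfg fB.
have [XN XB Xf] := fund_circuitP omN bgB fN.
have fX : f \in supp (fund_circuit Mbar (g |: B) f) by rewrite in_supp Xf.
have [_ ->] := spanning _ _ (subxx _) XN fX XB.
by rewrite setUA setUC.
Qed.
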